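(* Let $n\ge 2$ be even, $k\ge 1$, $\lambda<0$, $A_1<0$, $f(T)=A_1T$, and $R(x_{n+1})=\sum_{l=1}^{k}d_{2l}\,x_{n+1}^{2l}$ with $d_{2l}>0$ for $l=1,\dots,k$. Let $a_1,a_2\in\mathbb{R}$ and, for $j=2,\dots,n/2$, let $a_{2j-1},a_{2j}\in\mathbb{R}[x_1,\dots,x_{2j-2}]$, and suppose that for each $j=1,\dots,n/2$ one has $a_{2j-1}=a_{2j}$ or $a_{2j-1}=-a_{2j}$, and that $a_{2j-1}^2<\lambda/A_1$ (everywhere). Define $H=(H_1,\dots,H_n)$ by, for $j=1,\dots,n/2$, $$H_{2j-1}=a_{2j}\,f(a_{2j-1}x_{2j-1}+a_{2j}x_{2j}),\qquad H_{2j}=-a_{2j-1}\,f(a_{2j-1}x_{2j-1}+a_{2j}x_{2j}),$$ and, with $x=(x_1,\dots,x_n)$, let $F:\mathbb{R}^{n+1}\to\mathbb{R}^{n+1}$ be $$F(x_1,\dots,x_{n+1})=(-x_2,x_1,-x_4,x_3,\dots,-x_n,x_{n-1},-x_{n+1}R(x_{n+1}))+R(x_{n+1})\,(\lambda x+H(x),0).$$ Then the system $(\dot x_1,\dots,\dot x_{n+1})=F(x_1,\dots,x_{n+1})$ has the origin as an almost global attractor, and the origin is not locally asymptotically stable.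
   Context: The origin is an almost global attractor of a system $\dot x=F(x)$ (with $F\in C^1$, $F(0)=0$) if all trajectories, except for a set of initial states of Lebesgue measure zero, converge to the origin as $t\to+\infty$. In the definition of $H$, the coefficients $a_{2j-1},a_{2j}$ are evaluated at $(x_1,\dots,x_{2j-2})$ (constants when $j=1$). *)

(* Defs.v *)
From mathcomp Require Import all_boot all_order all_algebra.
From mathcomp Require Import all_classical all_reals all_analysis.
(* The notations of mpoly clash with those of MathComp-Analysis. *)
From mathcomp Require Import(canonicals) mpoly.

Set Implicit Arguments.
Unset Strict Implicit.
Unset Printing Implicit Defensive.

Import Order.TTheory GRing.Theory Num.Theory.
Import numFieldNormedType.Exports.

Local Open Scope classical_set_scope.
Local Open Scope ring_scope.

(** * Lebesgue-null sets of R^N *)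

(* MathComp-Analysis has Lebesgue measure on R only. This is the definition of
   Lebesgue outer measure zero in R^N: coverings by countably many closed boxes
   of arbitrarily small total volume. *)
Definition box (R : realType) (N : nat) (a b : 'rV[R]_N) : set 'rV[R]_N :=
  [set x | forall i : 'I_N, a 0 i <= x 0 i <= b 0 i].

Definition lebesgue_null (R : realType) (N : nat) (A : set 'rV[R]_N) : Prop :=
  forall e : R, 0 < e ->
  exists a b : nat -> 'rV[R]_N,
    [/\ forall k (i : 'I_N), a k 0 i <= b k 0 i,
        A `<=` \bigcup_k box (a k) (b k)
      & (\sum_(0 <= k <oo) (\prod_(i < N) (b k 0 i - a k 0 i))%:E <= e%:E)%E].

(** * Autonomous systems x' = F(x) and stability of the origin *)

(* The values of [x] at negative times are irrelevant. *)
Definition forward_solution (R : realType) (N : nat)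
    (F : 'rV[R]_N -> 'rV[R]_N) (x0 : 'rV[R]_N) (x : R -> 'rV[R]_N) : Prop :=
  [/\ x 0 = x0,
      {within `[0, +oo[, continuous x}
    & forall t : R, 0 < t -> is_derive t 1 x (F (x t))].

(* "The trajectory from x0 exists for all t >= 0 and satisfies P". For F of
   class C^1 the solution is unique; the conjunction with the universal clause
   makes the definition independent of that fact. *)
Definition trajectory_satisfies (R : realType) (N : nat)
    (F : 'rV[R]_N -> 'rV[R]_N) (x0 : 'rV[R]_N)
    (P : (R -> 'rV[R]_N) -> Prop) : Prop :=
  (exists x, forward_solution F x0 x) /\
  (forall x, forward_solution F x0 x -> P x).

Definition attracted (R : realType) (N : nat)
    (F : 'rV[R]_N -> 'rV[R]_N) (x0 : 'rV[R]_N) : Prop :=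
  trajectory_satisfies F x0
    (fun x => x t @[t --> +oo] --> (0 : 'rV[R]_N)).

Definition almost_global_attractor (R : realType) (N : nat)
    (F : 'rV[R]_N -> 'rV[R]_N) : Prop :=
  lebesgue_null [set x0 | ~ attracted F x0].

Definition lyapunov_stable (R : realType) (N : nat)
    (F : 'rV[R]_N -> 'rV[R]_N) : Prop :=
  forall e : R, 0 < e -> exists2 delta : R, 0 < delta &
    forall x0 : 'rV[R]_N, `|x0| < delta ->
      trajectory_satisfies F x0 (fun x => forall t, 0 <= t -> `|x t| < e).

Definition locally_attractive (R : realType) (N : nat)
    (F : 'rV[R]_N -> 'rV[R]_N) : Prop :=
  exists2 delta : R, 0 < delta &
    forall x0 : 'rV[R]_N, `|x0| < delta -> attracted F x0.

Definition locally_asymptotically_stable (R : realType) (N : nat)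
    (F : 'rV[R]_N -> 'rV[R]_N) : Prop :=
  lyapunov_stable F /\ locally_attractive F.

(** * The vector field *)

(* Indices below start at 0: [coordn x i] is x_(i+1) for i < n. The 0-based
   block j = 0, ..., n/2 - 1 consists of the coordinates x_(2j+1), x_(2j+2). *)
Definition coordn (R : realType) (n : nat) (x : 'rV[R]_n) (i : nat) : R :=
  oapp (fun k : 'I_n => x 0 k) 0 (insub i).

(* R(z) = d_2 z^2 + d_4 z^4 + ... + d_(2k) z^(2k) *)
Definition evenpoly (R : realType) (k : nat) (d : nat -> R) (z : R) : R :=
  \sum_(1 <= l < k.+1) d l.*2 * z ^+ l.*2.

(* A family [c] assigns to block j a polynomial in the 2j variables
   x_1, ..., x_(2j) of the preceding blocks (a constant for j = 0). *)
Definition coef_at (R : realType) (n : nat)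
    (c : forall j : nat, mpoly.mpoly j.*2 R) (x : 'rV[R]_n) (j : nat) : R :=
  mpoly.meval (fun i : 'I_j.*2 => coordn x i) (c j).

(* p j and q j are the coefficients a_(2j+1) and a_(2j+2). *)
Definition Hfield (R : realType) (n : nat) (f : R -> R)
    (p q : forall j : nat, mpoly.mpoly j.*2 R) (x : 'rV[R]_n) : 'rV[R]_n :=
  \row_(i < n)
    let j := i./2 in
    let s := coef_at p x j * coordn x j.*2 + coef_at q x j * coordn x j.*2.+1 in
    if odd i then - coef_at p x j * f s else coef_at q x j * f s.

(* (-x_2, x_1, -x_4, x_3, ..., -x_n, x_(n-1)) *)
Definition rotation (R : realType) (n : nat) (x : 'rV[R]_n) : 'rV[R]_n :=
  \row_(i < n) if odd i then coordn x i.-1 else - coordn x i.+1.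

Definition Ffield (R : realType) (n : nat) (lam : R) (Rf : R -> R)
    (H : 'rV[R]_n -> 'rV[R]_n) (X : 'rV[R]_(n + 1)) : 'rV[R]_(n + 1) :=
  let x : 'rV[R]_n := lsubmx X in
  let z : R := rsubmx X 0 0 in
  row_mx (rotation x) (- z * Rf z)%:M + Rf z *: row_mx (lam *: x + H x) 0.

(* Main.v *)
Require Import Defs.
From mathcomp Require Import all_boot all_order all_algebra.
From mathcomp Require Import all_classical all_reals all_analysis.
From mathcomp Require Import(canonicals) mpoly.
From mathcomp Require Import ring lra.

Import Order.TTheory GRing.Theory Num.Theory.
Import numFieldNormedType.Exports.

Local Open Scope classical_set_scope.
Local Open Scope ring_scope.

(* Write z for the last coordinate and (u, v) for the two coordinates of a
   block. Then z' = - z R(z), and since R(z) >= d_2 z^2, z tends to 0. The block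
   energy E = u^2 + v^2 satisfies
     E' = 2 R(z) (lam E +- A1 a^2 (u^2 - v^2)) <= 2 R(z) (lam - A1 a^2) E,
   where the coefficient a only depends on the preceding blocks. Once these tend
   to 0, a^2 tends to a(0)^2 < lam / A1, so that E' <= - 2 c R(z) E from some
   time on, for some c > 0. As w = z^2 satisfies w' = - 2 R(z) w, for m c >= 1 the
   quotient E^m / w is then nonincreasing, hence E tends to 0 along every
   trajectory with z(0) <> 0. On the null hyperplane z = 0 the energies are
   constant, so the origin does not attract a neighbourhood of itself.
   Global existence comes from the triangular structure: given z and the
   preceding blocks, a block solves a linear equation with bounded coefficients,
   the bound on a^2 being assumed everywhere. *)

(** * Functions on the half-line and their derivatives *)

Section Primitive.
Context {R : realType}.
Implicit Types (f g h df dg dh : R -> R).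

(** One-sided at 0, like [forward_solution]: continuity on the closed half-line and derivatives at
    positive times are what monotonicity arguments starting at time 0 use. *)
Definition primitive g dg : Prop :=
  {within `[0, +oo[, continuous g} /\ forall t : R, 0 < t -> is_derive t 1 g (dg t).

Lemma primitive_continuous g dg :
  continuous g -> (forall t : R, 0 < t -> is_derive t 1 g (dg t)) -> primitive g dg.
Proof. by move=> cg dgP; split=> //; exact: continuous_subspaceT. Qed.

Lemma primitive_eq g dg dg' :
  (forall t, 0 < t -> dg t = dg' t) -> primitive g dg -> primitive g dg'.
Proof. by move=> e [cg dP]; split=> // t t0; rewrite -e//; exact: dP. Qed.

Lemma primitive_cst c : primitive (fun=> c) (fun=> 0).
Proof.
split=> [|t t0]; last exact: is_derive_cst.
exact/continuous_subspaceT/cst_continuous.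
Qed.

Lemma primitiveD f g df dg : primitive f df -> primitive g dg ->
  primitive (fun t => f t + g t) (fun t => df t + dg t).
Proof.
move=> [cf fP] [cg gP]; split=> [x|t t0].
  by apply: continuousD; [exact: cf|exact: cg].
by apply: is_deriveD; [exact: fP|exact: gP].
Qed.

Lemma primitiveM f g df dg : primitive f df -> primitive g dg ->
  primitive (fun t => f t * g t) (fun t => f t * dg t + g t * df t).
Proof.
move=> [cf fP] [cg gP]; split=> [x|t t0].
  by apply: continuousM; [exact: cf|exact: cg].
by apply: is_deriveM; [exact: fP|exact: gP].
Qed.

Lemma primitiveN g dg : primitive g dg ->
  primitive (fun t => - g t) (fun t => - dg t).
Proof.
move=> [cg gP]; split=> [x|t t0]; first by apply: continuousN; exact: cg.
by apply: is_deriveN; exact: gP.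
Qed.

Lemma primitiveB f g df dg : primitive f df -> primitive g dg ->
  primitive (fun t => f t - g t) (fun t => df t - dg t).
Proof. by move=> fP gP; apply: primitiveD => //; exact: primitiveN. Qed.

Lemma primitiveX g dg n : primitive g dg ->
  primitive (fun t => g t ^+ n) (fun t => n%:R * g t ^+ n.-1 * dg t).
Proof.
move=> gP; elim: n => [|n IHn].
  by apply: primitive_eq (primitive_cst 1) => t _; rewrite !mul0r.
rewrite (_ : (fun t => _) = (fun t => g t * g t ^+ n)); last first.
  by apply/funext => t; rewrite exprS.
apply: primitive_eq (primitiveM _ _ _ _ gP IHn) => t _ /=.
case: n {IHn} => [|n] /=; first by rewrite !expr0; ring.
by rewrite exprS -(natr1 n.+1); ring.
Qed.

Lemma primitiveV g dg : (forall t, 0 <= t -> g t != 0) -> primitive g dg ->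
  primitive (fun t => (g t)^-1) (fun t => - (g t) ^- 2 * dg t).
Proof.
move=> g0 [cg gP]; split.
  apply/subspace_continuousP => x /= x0; apply: cvgV.
    by apply: g0; move: x0; rewrite in_itv/= andbT.
  by move/subspace_continuousP : cg; exact.
move=> t t0; have gt0 := g0 _ (ltW t0).
have gd := gP _ t0; split; first exact: derivableV.
by rewrite deriveV// derive_val.
Qed.

Lemma primitive_nincr g dg a : 0 <= a -> primitive g dg ->
  (forall t, a < t -> dg t <= 0) ->
  forall s t, a <= s -> s <= t -> g t <= g s.
Proof.
move=> a0 [cg gP] g0 s t as_ st.
apply: (@ler0_derive1_nincry _ g a) => // [x|x|].
- by rewrite in_itv/= andbT => ax; have [] := gP _ (le_lt_trans a0 ax).
- rewrite in_itv/= andbT => ax; have [_] := gP _ (le_lt_trans a0 ax).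
  by rewrite derive1E => ->; exact: g0.
- apply: continuous_subspaceW cg => x /=.
  by rewrite !in_itv/= !andbT => /(le_trans a0).
Qed.

(** Both [g - h] and [- g - h] are nonincreasing and start at or below 0. This stands in for
    bounding an integral by the integral of a bound. *)
Lemma primitive_ler_norm g dg h dh : primitive g dg -> primitive h dh ->
  (forall t, 0 < t -> `|dg t| <= dh t) -> `|g 0| <= h 0 ->
  forall t, 0 <= t -> `|g t| <= h t.
Proof.
move=> gP hP le_d; rewrite !ler_norml => /andP[ge0 le0] t t0.
have : g t - h t <= g 0 - h 0.
  apply: (primitive_nincr _ _ 0 _ (primitiveB _ _ _ _ gP hP)) => // s /le_d.
  by rewrite ler_norml => /andP[? ?] /=; lra.
have : - g t - h t <= - g 0 - h 0.
  apply: (primitive_nincr _ _ 0 _ (primitiveB _ _ _ _ (primitiveN _ _ gP) hP)) => //.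
  by move=> s /le_d; rewrite ler_norml => /andP[? ?] /=; lra.
by rewrite ler_norml => ? ?; apply/andP; split; lra.
Qed.

(** Freezing [G] at 0 for negative times keeps it continuous on the whole line, so that it can be
    fed back into the Picard iteration. *)
Lemma exists_primitive g : continuous g ->
  exists G : R -> R, [/\ continuous G, G 0 = 0, forall t : R, t <= 0 -> G t = 0 &
    forall t : R, 0 < t -> is_derive t 1 G (g t)].
Proof.
(* The base point -1 makes 0 an interior point, where the fundamental theorem of calculus still
   gives differentiability, hence continuity, of [K]. *)
move=> cg; pose K (x : R) := (\int[lebesgue_measure]_(t in `[-1, x]) g t)%R.
have KP (x : R) : -1 < x -> is_derive x 1 K (g x).
  move=> x1; have [||dK KE] := @continuous_FTC1_closed R g (-1) x (x + 1) _ _ x1 (cg x).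
  - by rewrite ltrDl.
  - apply: continuous_compact_integrable; first exact: segment_compact.
    exact: continuous_subspaceT.
  - by split => //; rewrite -derive1E.
exists (fun t => K (Num.max t 0) - K 0); split.
- move=> t; apply: cvgB; last exact: cvg_cst.
  have cm : {for t, continuous (fun s : R => Num.max s 0)}.
    by apply: (@continuous_max _ _ id (fun=> 0)); [exact: cvg_id|exact: cvg_cst].
  apply: (@cvg_comp _ _ _ (fun s : R => Num.max s 0) K _ _ _ cm).
  apply: differentiable_continuous; apply/derivable1_diffP.
  have [|//] := KP (Num.max t 0) _; rewrite lt_max; apply/orP; right; lra.
- by rewrite maxxx subrr.
- by move=> t t0; rewrite max_r// subrr.
- move=> t t0; apply: (@near_eq_is_derive _ _ _ (fun t => K t - K 0)).
  + near=> s; rewrite max_l//; apply: ltW; near: s; exact: lt_nbhsr.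
  + rewrite -[g t]subr0; apply: is_deriveB; apply: KP; lra.
Unshelve. all: by end_near. Qed.

End Primitive.

(** * Global Picard iteration *)

Section Picard.
Context {R : realType}.

(** The increments are summable, so the sequence is Cauchy. The explicit rate is recorded because
    the locally uniform convergence of the Picard iterates is read off from it. *)
Lemma cauchy_geometric_lim (u : nat -> R) (D : R) :
  (forall k, `|u k.+1 - u k| <= D * 2^-1 ^+ k) ->
  exists l, forall k, `|l - u k| <= 2 * D * 2^-1 ^+ k.
Proof.
move=> uD.
have D0 : 0 <= D by have := uD 0; rewrite expr0 mulr1; exact: le_trans.
(* The right-hand side is the exact partial geometric sum, which lets the induction on [j] close. *)
have tail k j : `|u (k + j)%N - u k| <= 2 * D * 2^-1 ^+ k * (1 - 2^-1 ^+ j).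
  elim: j => [|j IHj]; first by rewrite addn0 !subrr normr0 mulr0.
  rewrite addnS -(subrKA (u (k + j)%N)) (le_trans (ler_normD _ _))//.
  apply: le_trans (lerD (uD _) IHj) _.
  by rewrite exprD exprS le_eqVlt; apply/orP; left; apply/eqP; field.
have tail' k m : (k <= m)%N -> `|u m - u k| <= 2 * D * 2^-1 ^+ k.
  move=> km; rewrite -(subnKC km); apply: le_trans (tail _ _) _.
  have h0 (i : nat) : 0 <= (2^-1 : R) ^+ i by rewrite exprn_ge0// invr_ge0.
  rewrite -[leRHS]mulr1 ler_wpM2l//; first by rewrite mulr_ge0// mulr_ge0.
have half0 : (2^-1 : R) ^+ n @[n --> \oo] --> (0 : R).
  by apply: cvg_expr; rewrite ger0_norm ?invr_ge0// invf_lt1// ltr1n.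
have cu : cvgn u.
  apply/cauchy_cvgP/cauchy_exP => e e0.
  have : \forall k \near \oo, 2 * D * 2^-1 ^+ k < e.
    have : 2 * D * 2^-1 ^+ n @[n --> \oo] --> 2 * D * (0 : R).
      by apply: cvgM; [exact: cvg_cst|exact: half0].
    by rewrite mulr0 => /cvgr_lt; apply.
  move=> [k _ /(_ k (leqnn _)) ke]; exists (u k); exists k => // m /= km.
  by rewrite -ball_normE /= distrC (le_lt_trans (tail' _ _ km)).
exists (lim (u @ \oo)) => k.
have cuk : `|u m - u k| @[m --> \oo] --> `|lim (u @ \oo) - u k|.
  by apply: cvg_norm; apply: cvgB => //; exact: cvg_cst.
apply: (@closed_cvg _ _ \oo _ _ [set x : R | x <= 2 * D * 2^-1 ^+ k] _ _ _ cuk).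
  exact: closed_le.
by exists k => // m /=; exact: tail'.
Qed.

Lemma primitive_expR (c L : R) :
  primitive (fun t => c * expR (L * t)) (fun t => c * L * expR (L * t)).
Proof.
have eP : primitive (fun t : R => expR (L * t)) (fun t => L * expR (L * t)).
  apply: primitive_continuous => [|t t0].
    move=> t; apply: (@continuous_comp _ _ _ ( *%R L) expR).
      exact: mulrl_continuous.
    exact: continuous_expR.
  have dL : is_derive t 1 ( *%R L) L.
    by rewrite -[X in is_derive _ _ _ X]mulr1; apply: is_deriveZ.
  by rewrite mulrC; exact: (@is_derive1_comp _ expR ( *%R L)).
apply: primitive_eq (primitiveM _ _ _ _ (primitive_cst c) eP) => t _ /=.
by ring.
Qed.

(* The weight [expR (2 * L * t)] makes the Picard operator a contraction of
   ratio 1/2 on the whole half-line. *)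
Lemma picard {I : Type} (f : R -> (I -> R) -> I -> R) (y0 : I -> R) (L C : R) : 0 < L ->
  (forall t : R, 0 <= t -> forall (a b : I -> R) (D : R), (forall i, `|a i - b i| <= D) ->
     forall i, `|f t a i - f t b i| <= L * D) ->
  (forall (t : R) i, 0 <= t -> `|f t y0 i| <= C) ->
  (forall y : I -> R -> R, (forall i, continuous (y i)) ->
     forall i, continuous (fun t => f t (y^~ t) i)) ->
  exists y : I -> R -> R, forall i,
    [/\ continuous (y i), y i 0 = y0 i &
        forall t : R, 0 < t -> is_derive t 1 (y i) (f t (y^~ t) i)].
Proof.
move=> L0 lip bnd cont.
(* Antiderivation becomes a total operator [A]; its value at a discontinuous [g] is an arbitrary
   default. *)
have /choice[A AP] (g : R -> R) : exists G : R -> R, continuous g ->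
    [/\ continuous G, G 0 = 0, forall t : R, t <= 0 -> G t = 0 &
    forall t : R, 0 < t -> is_derive t 1 G (g t)].
  have [cg|ncg] := pselect (continuous g); last by exists (fun=> 0).
  by have [G GP] := exists_primitive g cg; exists G.
pose T (y : I -> R -> R) i t := y0 i + A (fun s => f s (y^~ s) i) t.
have TP (y : I -> R -> R) : (forall i, continuous (y i)) -> forall i,
    [/\ continuous (T y i), forall t : R, t <= 0 -> T y i t = y0 i &
        forall t : R, 0 < t -> is_derive t 1 (T y i) (f t (y^~ t) i)].
  move=> cy i; have [cA _ A0 dA] := AP _ (cont _ cy i); split.
  - by move=> t; apply: cvgD; [exact: cvg_cst|exact: cA].
  - by move=> t t0; rewrite /T A0// addr0.
  - move=> t t0; rewrite -[f _ _ _]add0r; apply: is_deriveD; exact: dA.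
have TN (y : I -> R -> R) i (t : R) : (forall i, continuous (y i)) -> t <= 0 -> T y i t = y0 i.
  by move=> cy t0; have [_ TN _] := TP _ cy i; exact: TN.
pose Y k := iter k T (fun i _ => y0 i).
have cY k i : continuous (Y k i).
  elim: k i => [|k IHk] i; first exact: cst_continuous.
  by have [] := TP _ IHk i.
have pT (y : I -> R -> R) i : (forall i, continuous (y i)) ->
    primitive (T y i) (fun t => f t (y^~ t) i).
  by move=> /TP/(_ i)[cT _ dT]; exact: primitive_continuous.
have YN k i (t : R) : t <= 0 -> Y k i t = y0 i.
  by case: k => [//|k]; exact: TN.
(* Chosen so that the derivative of [D * E t] is [|C| * E t], which dominates the first increment's
   derivative. *)
pose D := `|C| / (2 * L).
have D0 : 0 <= D by rewrite divr_ge0// mulr_ge0// ltW.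
pose E (t : R) := expR (2 * L * t).
have E1 (t : R) : 0 <= t -> 1 <= E t.
  by move=> t0; rewrite -expR0 ler_expR mulr_ge0// mulr_ge0// ltW.
have h0 (i : nat) : 0 <= (2^-1 : R) ^+ i by rewrite exprn_ge0// invr_ge0.
(* The derivative of the bound at rank [k.+1] is exactly [L] times the bound at rank [k], which is
   what the Lipschitz hypothesis yields. *)
have step k i (t : R) : 0 <= t -> `|Y k.+1 i t - Y k i t| <= D * 2^-1 ^+ k * E t.
  elim: k i t => [|k IHk] i.
    apply: (primitive_ler_norm _ _ _ _
      (primitiveB _ _ _ _ (pT _ i (cY 0)) (primitive_cst (y0 i)))
      (primitive_expR (D * 2^-1 ^+ 0) (2 * L))).
      move=> t t0; rewrite subr0 expr0 mulr1 /D.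
      have -> : `|C| / (2 * L) * (2 * L) = `|C|.
        by rewrite divfK// gt_eqF// mulr_gt0.
      apply: le_trans (bnd _ _ (ltW t0)) _.
      rewrite (le_trans (ler_norm _))// ler_peMr//; apply: E1; exact: ltW.
    by rewrite (TN _ _ _ (cY 0))// subrr normr0 mulr_ge0// ?expR_ge0// mulr_ge0.
  apply: (primitive_ler_norm _ _ _ _
      (primitiveB _ _ _ _ (pT _ i (cY k.+1)) (pT _ i (cY k)))
      (primitive_expR (D * 2^-1 ^+ k.+1) (2 * L))).
    move=> t t0; have -> : D * 2^-1 ^+ k.+1 * (2 * L) * expR (2 * L * t) =
        L * (D * 2^-1 ^+ k * E t) by rewrite exprS /E; field.
    by apply: lip; [exact: ltW|move=> j; apply: IHk; exact: ltW].
  rewrite (TN _ _ _ (cY k.+1))// (TN _ _ _ (cY k))// subrr normr0.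
  by rewrite mulr_ge0// ?expR_ge0// mulr_ge0.
(* The weight is extended by 1 to negative times, where all iterates equal [y0]. *)
pose F (t : R) := E (Num.max t 0).
have stepF k i (t : R) : `|Y k.+1 i t - Y k i t| <= (D * F t) * 2^-1 ^+ k.
  have -> : D * F t * 2^-1 ^+ k = D * 2^-1 ^+ k * F t by ring.
  have [t0|t0] := leP 0 t; first by rewrite /F max_l//; exact: step.
  have tle := ltW t0; rewrite !YN// subrr normr0.
  by rewrite (mulr_ge0 (mulr_ge0 D0 (h0 k)))// expR_ge0.
have /choice[y yP] (i : I) : exists y : R -> R, forall t k,
    `|y t - Y k i t| <= 2 * (D * F t) * 2^-1 ^+ k.
  have /choice[y yP] (t : R) : exists l, forall k,
      `|l - Y k i t| <= 2 * (D * F t) * 2^-1 ^+ k.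
    by apply: cauchy_geometric_lim => k; exact: stepF.
  by exists y.
have half0 (c e : R) : 0 < e -> exists k, c * 2^-1 ^+ k < e.
  move=> e0; have : c * 2^-1 ^+ n @[n --> \oo] --> c * (0 : R).
    apply: cvgM; first exact: cvg_cst.
    by apply: cvg_expr; rewrite ger0_norm ?invr_ge0// invf_lt1// ltr1n.
  rewrite mulr0 => /cvgr_lt/(_ _ e0)[k _ /(_ k (leqnn _)) ke].
  by exists k.
have cy i : continuous (y i).
  move=> t; apply/cvgrPdist_lt => e e0.
  (* The weight near [t] is at most its value at [|t| + 1], so one rank [k] serves a whole
     neighbourhood and an argument with three parts of size [e / 3] applies. *)
  have [k ke] := half0 (2 * (D * F (`|t| + 1))) (e / 3) (divr_gt0 e0 (ltr0n _ 3)).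
  have FF (s : R) : `|t - s| < 1 -> F s <= F (`|t| + 1).
    move=> ts; rewrite /F /E ler_expR ler_wpM2l// ?mulr_ge0//; first exact: ltW.
    rewrite [leRHS]max_l ?addr_ge0// ge_max addr_ge0// andbT.
    have -> : s = t - (t - s) by ring.
    by rewrite (le_trans (ler_norm _))// (le_trans (ler_normB _ _))// lerD// ltW.
  have yk (s : R) : `|t - s| < 1 -> `|y i s - Y k i s| < e / 3.
    move=> ts; apply: le_lt_trans (yP i s k) _; apply: le_lt_trans ke.
    by rewrite ler_wpM2r// ler_wpM2l// ler_wpM2l// FF.
  have tt : `|t - t| < 1 by rewrite subrr normr0.
  near=> s.
  have ts : `|t - s| < 1.
    by near: s; exists 1 => //=.
  have ykt := yk _ tt; have yks := yk _ ts.
  have YY : `|Y k i t - Y k i s| < e / 3.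
    near: s; move/cvgrPdist_lt : (cY k i t); apply; exact: divr_gt0.
  have -> : y i t - y i s = (y i t - Y k i t) + (Y k i t - Y k i s)
      - (y i s - Y k i s) by ring.
  apply: le_lt_trans (ler_normB _ _) _.
  have := ler_normD (y i t - Y k i t) (Y k i t - Y k i s).
  by lra.
(* Both [y] and [T y] are limits of the same iterates: each differs from [Y k.+1] by a multiple of
   [2^-1 ^+ k]. *)
have yT i (t : R) : 0 <= t -> y i t = T y i t.
  move=> t0.
  have yTk k : `|y i t - T y i t| <= 2 * D * E t * 2^-1 ^+ k.
    have TT : `|Y k.+1 i t - T y i t| <= D * 2^-1 ^+ k * E t.
      apply: (primitive_ler_norm _ _ _ _
        (primitiveB _ _ _ _ (pT _ i (cY k)) (pT _ i cy))
        (primitive_expR (D * 2^-1 ^+ k) (2 * L))) => //.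
        move=> s s0; have -> : D * 2^-1 ^+ k * (2 * L) * expR (2 * L * s) =
            L * (2 * (D * F s) * 2^-1 ^+ k).
          by rewrite /F max_l ?ltW// /E; ring.
        by apply: lip; [exact: ltW|move=> j; rewrite distrC; exact: yP].
      by rewrite (TN _ _ _ (cY k))// TN// subrr normr0 mulr_ge0// ?expR_ge0// mulr_ge0.
    rewrite -(subrKA (Y k.+1 i t)); apply: le_trans (ler_normD _ _) _.
    apply: le_trans (lerD (yP i t k.+1) TT) _.
    by rewrite /F max_l// exprS le_eqVlt; apply/orP; left; apply/eqP; field.
  apply/eqP; rewrite -subr_eq0 -normr_le0; apply/ler_addgt0Pl => e e0.
  rewrite addr0; have [k /ltW ke] := half0 (2 * D * E t) e e0.
  exact: le_trans (yTk k) ke.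
(* [T y] has its derivative by construction, expressed through [y]; the two agree at nonnegative
   times, which turns this into the equation for [T y]. *)
exists (T y) => i; have [cT T0 dT] := TP _ cy i; split => //; first exact: T0.
move=> t t0; have -> : (T y)^~ t = y^~ t; last exact: dT.
by apply/funext => j; rewrite yT// ltW.
Unshelve. all: by end_near. Qed.

End Picard.

(** * Decay estimates *)

Section Decay.
Context {R : realType}.
Implicit Types w E r : R -> R.

Lemma nincr_cvg0 w : (forall t : R, 0 <= t -> 0 <= w t) ->
  (forall s t : R, 0 <= s -> s <= t -> w t <= w s) ->
  (forall e : R, 0 < e -> exists2 t, 0 <= t & w t < e) ->
  w t @[t --> +oo] --> 0.
Proof.
move=> w0 wd wlt; apply/cvgrPdist_lt => e e0; have [s s0 se] := wlt _ e0.
near=> t.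
have st : s <= t by near: t; apply: nbhs_pinfty_ge; exact: num_real.
rewrite sub0r normrN ger0_norm; last by rewrite w0// (le_trans s0).
exact: le_lt_trans (wd _ _ s0 st) se.
Unshelve. all: by end_near. Qed.

(** If [w] stayed above [e], then [w t + c * e ^+ 2 * t] would be nonincreasing, which forces
    [w T <= 0] at [T = w 0 / (c * e ^+ 2)]. *)
Lemma quadratic_decay w dw (c : R) : 0 < c -> primitive w dw ->
  (forall t : R, 0 <= t -> 0 <= w t) ->
  (forall t : R, 0 < t -> dw t <= - c * w t ^+ 2) ->
  w t @[t --> +oo] --> 0.
Proof.
move=> c0 wP w0 dwle.
have wd : forall s t : R, 0 <= s -> s <= t -> w t <= w s.
  apply: (primitive_nincr _ _ 0 (lexx _) wP) => t /dwle; move/le_trans; apply.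
  by rewrite mulNr oppr_le0 mulr_ge0// ?sqr_ge0// ltW.
apply: nincr_cvg0 => // e e0; apply: contrapT => /forall2NP wge.
have {}wge t : 0 <= t -> e <= w t.
  by move=> t0; case: (wge t) => // /negP; rewrite -leNgt.
pose K := c * e ^+ 2.
have K0 : 0 < K by rewrite mulr_gt0// exprn_gt0.
have idP : primitive (fun t : R => t) (fun=> 1).
  split=> [|t _]; last exact: is_derive_id.
  by apply: continuous_subspaceT => t; exact: cvg_id.
have hP := primitiveD _ _ _ _ wP (primitiveM _ _ _ _ (primitive_cst K) idP).
pose T := w 0 / K.
have T0 : 0 <= T by rewrite divr_ge0 ?w0// ltW.
have := primitive_nincr _ _ 0 (lexx _) hP _ 0 T (lexx _) T0.
rewrite mulr0 addr0 => H.
have : w T + K * T <= w 0.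
  apply: H => t t0 /=; have := dwle _ t0; have := wge _ (ltW t0) => et.
  have : e ^+ 2 <= w t ^+ 2 by rewrite ler_pXn2r// ?nnegrE ?(ltW e0)// w0// ltW.
  rewrite -(ler_pM2l c0) /K; lra.
rewrite /T mulrCA divff ?gt_eqF// mulr1; have := wge _ T0; lra.
Qed.

(** The product [w t * expR (K * t)] is nondecreasing, so [w] cannot reach 0 in finite time and may
    serve as a denominator. *)
Lemma linear_decay_gt0 w r (K : R) : primitive w (fun t => - r t * w t) ->
  (forall t : R, 0 <= t -> 0 <= w t) -> (forall t : R, 0 < t -> r t <= K) ->
  0 < w 0 -> forall t : R, 0 <= t -> 0 < w t.
Proof.
move=> wP w0 rK w00 t t0.
have gP := primitiveN _ _ (primitiveM _ _ _ _ wP (primitive_expR 1 K)).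
have := primitive_nincr _ _ 0 (lexx _) gP _ 0 t (lexx _) t0.
rewrite mulr0 expR0 !mul1r mulr1 => H.
have : 0 < w t * expR (K * t).
  apply: lt_le_trans w00 _; rewrite -lerN2; apply: H => s s0 /=.
  have -> : - (w s * (K * expR (K * s)) + 1 * expR (K * s) * (- r s * w s)) =
      - ((K - r s) * (w s * expR (K * s))) by ring.
  rewrite oppr_le0 mulr_ge0//; first by rewrite subr_ge0 rK.
  by rewrite mulr_ge0 ?expR_ge0// w0// ltW.
by rewrite pmulr_lgt0// expR_gt0.
Qed.

(* [E ^+ m / w] is nonincreasing as soon as [1 <= m * c]. *)
Lemma comparison_cvg0 E dE w r (c T : R) : 0 <= T -> 0 < c ->
  primitive E dE -> primitive w (fun t => - r t * w t) ->
  (forall t : R, 0 <= r t) -> (forall t : R, 0 <= E t) ->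
  (forall t : R, 0 <= t -> 0 < w t) -> w t @[t --> +oo] --> 0 ->
  (forall t : R, T < t -> dE t <= - c * r t * E t) ->
  E t @[t --> +oo] --> 0.
Proof.
move=> T0 c0 EP wP r0 E0 w0 wcvg dEle.
pose m := (Num.bound c^-1).+1.
have mc : 1 <= m%:R * c.
  have ci0 : 0 <= c^-1 by rewrite invr_ge0 ltW.
  rewrite -ler_pdivrMr// div1r; apply: le_trans (ltW (archi_boundP ci0)) _.
  by rewrite ler_nat.
have gP := primitiveM _ _ _ _ (primitiveX _ _ m EP)
  (primitiveV _ _ (fun t t0 => lt0r_neq0 (w0 t t0)) wP).
have := primitive_nincr _ _ T T0 gP.
pose G := E T ^+ m / w T => H.
have G0 : 0 <= G by rewrite divr_ge0 ?exprn_ge0// ltW// w0.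
have Ele t : T <= t -> E t ^+ m <= G * w t.
  move=> Tt; rewrite -ler_pdivrMr ?w0 ?(le_trans T0)//.
  apply: H => // s Ts /=; have s0 := le_lt_trans T0 Ts.
  (* By the bound on [dE s], the derivative of [E ^+ m / w] is at most
     [(1 - m%:R * c) * r s * E s ^+ m / w s], which is nonpositive. *)
  have ws := w0 _ (ltW s0); have dEs := dEle _ Ts.
  have -> : E s ^+ (Num.bound c^-1).+1 * (- w s ^- 2 * (- r s * w s)) =
      r s * (w s)^-1 * (E s * E s ^+ Num.bound c^-1).
    by rewrite exprS; field; rewrite gt_eqF.
  have k0 : 0 <= m%:R * E s ^+ Num.bound c^-1 / w s.
    by rewrite !mulr_ge0// ?exprn_ge0// invr_ge0 ltW.
  have := ler_wpM2l k0 dEs.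
  pose X := E s ^+ Num.bound c^-1 / w s.
  have X0 : 0 <= r s * E s * X by rewrite !mulr_ge0// ?exprn_ge0// invr_ge0 ltW.
  have := ler_wpM2r X0 mc.
  rewrite /X; lra.
(* The denominator is [G + 1] because [G] vanishes when [E T = 0]. *)
apply/cvgrPdist_lt => e e0; have em : 0 < e ^+ m / (G + 1).
  by rewrite divr_gt0// ?exprn_gt0// ltr_wpDl.
near=> t.
have Tt : T <= t by near: t; apply: nbhs_pinfty_ge; exact: num_real.
have wt : w t < e ^+ m / (G + 1).
  have : `|0 - w t| < e ^+ m / (G + 1).
    by near: t; move/cvgrPdist_lt : wcvg; exact.
  by rewrite sub0r normrN gtr0_norm// w0// (le_trans T0).
rewrite sub0r normrN ger0_norm//.
rewrite -(@ltr_pXn2r _ m)// ?nnegrE ?(ltW e0)//.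
apply: le_lt_trans (Ele _ Tt) _.
rewrite ltr_pdivlMr ?ltr_wpDl// in wt.
apply: le_lt_trans wt; rewrite mulrC ler_wpM2l// ?lerDl//.
by rewrite ltW// w0// (le_trans T0).
Unshelve. all: by end_near. Qed.

End Decay.

(** * Energy of one planar block *)

Section BlockEnergy.
Context {R : realType}.
Variables (lam A1 : R) (r a b u v : R -> R).
Hypothesis A1_lt0 : A1 < 0.
Hypothesis uP : primitive u (fun t => - v t +
  r t * (lam * u t + b t * (A1 * (a t * u t + b t * v t)))).
Hypothesis vP : primitive v (fun t => u t +
  r t * (lam * v t - a t * (A1 * (a t * u t + b t * v t)))).

Let E t := u t ^+ 2 + v t ^+ 2.

(** The rotation contributes [- 2 * u * v + 2 * v * u = 0], so every remaining term carries the
    factor [r]. *)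
Lemma block_energy : primitive E (fun t => 2 * r t *
  (lam * E t + A1 * ((a t * u t + b t * v t) * (b t * u t - a t * v t)))).
Proof.
have EP := primitiveD _ _ _ _ (primitiveX _ _ 2 uP) (primitiveX _ _ 2 vP).
by apply: primitive_eq EP => t _ /=; rewrite /E; ring.
Qed.

(** For [b = a] or [b = - a] the product is [a ^+ 2 * (u ^+ 2 - v ^+ 2)] up to sign, hence at least
    [- a ^+ 2 * E]; multiplying by [A1 < 0] turns this into an upper bound. *)
Lemma block_energy_le (s t : R) : 0 <= r t -> b t = a t \/ b t = - a t ->
  a t ^+ 2 <= s ->
  2 * r t *
  (lam * E t + A1 * ((a t * u t + b t * v t) * (b t * u t - a t * v t))) <=
  2 * r t * (lam - A1 * s) * E t.
Proof.
move=> r0 ab as_; rewrite -[leRHS]mulrA ler_wpM2l ?mulr_ge0//.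
have E0 : 0 <= E t by rewrite addr_ge0 ?sqr_ge0.
have -> : (lam - A1 * s) * E t = lam * E t + A1 * - (s * E t) by ring.
rewrite lerD2l ler_nM2l//.
apply: (@le_trans _ _ (- (a t ^+ 2 * E t))); first by rewrite lerN2 ler_wpM2r.
have := mulr_ge0 (sqr_ge0 (a t)) (sqr_ge0 (u t)).
have := mulr_ge0 (sqr_ge0 (a t)) (sqr_ge0 (v t)).
by rewrite /E; case: ab => ->; lra.
Qed.

End BlockEnergy.

(** * The scalar equation z' = - z R(z) *)

Section EvenPolynomial.
Context {R : realType}.
Variables (k : nat) (d : nat -> R).
Hypothesis k_gt0 : (1 <= k)%N.
Hypothesis d_gt0 : forall l : nat, (1 <= l <= k)%N -> 0 < d l.*2.

Lemma evenpoly0 : evenpoly k d 0 = 0.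
Proof.
rewrite /evenpoly big_nat big1// => l /andP[l0 _].
by rewrite expr0n double_eq0 -leqn0 leqNgt l0 mulr0.
Qed.

Lemma expr_double_ge0 (x : R) l : 0 <= x ^+ l.*2.
Proof. by rewrite exprn_even_ge0// odd_double. Qed.

Lemma evenpoly_ge (x : R) : d 2 * x ^+ 2 <= evenpoly k d x.
Proof.
rewrite /evenpoly big_ltn ?ltnS// lerDl big_nat sumr_ge0// => l /andP[l1 lk].
by rewrite mulr_ge0 ?expr_double_ge0// ltW// d_gt0// (ltnW l1).
Qed.

Lemma evenpoly_ge0 (x : R) : 0 <= evenpoly k d x.
Proof.
by apply: le_trans (evenpoly_ge x); rewrite mulr_ge0 ?sqr_ge0// ltW// (d_gt0 1).
Qed.

Lemma evenpoly_le (x y : R) : `|x| <= `|y| -> evenpoly k d x <= evenpoly k d y.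
Proof.
move=> xy; apply: ler_sum_nat => l /andP[l0 lk].
rewrite ler_pM2l ?d_gt0 ?l0//.
rewrite -[leLHS]ger0_norm ?expr_double_ge0//.
rewrite -[leRHS]ger0_norm ?expr_double_ge0//.
by rewrite !normrX lerXn2r// nnegrE.
Qed.

Lemma continuous_evenpoly : continuous (evenpoly k d).
Proof.
apply: continuous_big => [|l _ x]; first exact: add_continuous.
by apply: cvgM; [exact: cvg_cst|exact: exprn_continuous].
Qed.

(** Boundedness is included so that the class is closed under products, hence under polynomials in a
    clamped variable. *)
Definition bounded_lipschitz (g : R -> R) : Prop :=
  exists2 K : R, (forall x y : R, `|g x - g y| <= K * `|x - y|) &
    forall x : R, `|g x| <= K.

Lemma bounded_lipschitz_cst (e : R) : bounded_lipschitz (fun=> e).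
Proof.
by exists `|e| => // x y; rewrite subrr normr0 mulr_ge0.
Qed.

Lemma bounded_lipschitzD g h : bounded_lipschitz g -> bounded_lipschitz h ->
  bounded_lipschitz (fun x => g x + h x).
Proof.
move=> [K gK gB] [K' hK hB]; exists (K + K') => [x y|x].
  rewrite opprD addrACA mulrDl; apply: le_trans (ler_normD _ _) _.
  exact: lerD.
by apply: le_trans (ler_normD _ _) _; exact: lerD.
Qed.

Lemma bounded_lipschitzM g h : bounded_lipschitz g -> bounded_lipschitz h ->
  bounded_lipschitz (fun x => g x * h x).
Proof.
move=> [K gK gB] [K' hK hB].
have K0 : 0 <= K by exact: le_trans (gB 0).
have K'0 : 0 <= K' by exact: le_trans (hB 0).
exists (2 * (K * K')) => [x y|x]; last first.
  rewrite normrM; apply: (@le_trans _ _ (K * K')); first exact: ler_pM.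
  by rewrite ler_peMl ?mulr_ge0// ler1n.
have -> : g x * h x - g y * h y = g x * (h x - h y) + h y * (g x - g y) by ring.
apply: le_trans (ler_normD _ _) _; rewrite !normrM.
have := ler_pM (normr_ge0 _) (normr_ge0 _) (gB x) (hK x y).
have := ler_pM (normr_ge0 _) (normr_ge0 _) (hB y) (gK x y).
by lra.
Qed.

Definition clamp (M x : R) : R := Num.max (- M) (Num.min x M).

Lemma clamp_id M x : `|x| <= M -> clamp M x = x.
Proof. by rewrite ler_norml /clamp => /andP[? ?]; rewrite min_l// max_r. Qed.

Lemma bounded_lipschitz_clamp M : 0 <= M -> bounded_lipschitz (clamp M).
Proof.
move=> M0; exists (1 + M) => [x y|x]; last first.
  by rewrite /clamp ler_norml /Num.max /Num.min; do !case: ifP; lra.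
apply: (@le_trans _ _ `|x - y|); last by rewrite ler_peMl// lerDl.
wlog xy : x y / x <= y => [hw|].
  by have [/hw//|/ltW/hw] := leP x y; rewrite distrC (distrC y).
have cxy : clamp M x <= clamp M y.
  by rewrite /clamp ge_max !le_max lexx/= le_min !ge_min xy lexx !orbT.
rewrite distrC (distrC x) !ger0_norm ?subr_ge0//.
by rewrite /clamp /Num.max /Num.min; do !case: ifPn; rewrite -?leNgt; lra.
Qed.

(** Clamping preserves sign, so the clamped equation still makes [z ^+ 2] decrease. *)
Lemma mul_clamp_ge0 M x : 0 <= M -> 0 <= x * clamp M x.
Proof.
move=> M0; have [x0|x0] := leP 0 x.
  by rewrite mulr_ge0// /clamp le_max le_min x0 M0 orbT.
by rewrite nmulr_rge0// /clamp ge_max oppr_le0 M0 ge_min (ltW x0).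
Qed.

(* Clamping makes the equation globally Lipschitz, and it is inactive because
   [z ^+ 2] decreases. *)
Lemma exists_scalar_solution (z0 : R) : exists z : R -> R,
  [/\ continuous z, z 0 = z0 &
      forall t : R, 0 < t -> is_derive t 1 z (- z t * evenpoly k d (z t))].
Proof.
pose M := `|z0|; have M0 : 0 <= M by exact: normr_ge0.
pose g x := - clamp M x * evenpoly k d (clamp M x).
have [K gK gB] : bounded_lipschitz g.
  have cL := bounded_lipschitz_clamp M M0.
  apply: bounded_lipschitzM.
    under [X in bounded_lipschitz X]eq_fun do rewrite -mulN1r.
    by apply: bounded_lipschitzM => //; exact: bounded_lipschitz_cst.
  rewrite /evenpoly; elim: (index_iota 1 k.+1) => [|l s IHs].
    under [X in bounded_lipschitz X]eq_fun do rewrite big_nil.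
    exact: bounded_lipschitz_cst.
  under [X in bounded_lipschitz X]eq_fun do rewrite big_cons.
  apply: bounded_lipschitzD => //; apply: bounded_lipschitzM.
    exact: bounded_lipschitz_cst.
  elim: (l.*2) => [|i IHi].
    under [X in bounded_lipschitz X]eq_fun do rewrite expr0.
    exact: bounded_lipschitz_cst.
  under [X in bounded_lipschitz X]eq_fun do rewrite exprS.
  exact: bounded_lipschitzM.
have K0 : 0 <= K by exact: le_trans (gB 0).
have gc : continuous g.
  move=> x; apply/cvgrPdist_lt => e e0.
  have eK : 0 < e / (K + 1) by rewrite divr_gt0// ltr_wpDl.
  near=> y; apply: le_lt_trans (gK _ _) _.
  have : `|x - y| < e / (K + 1).
    by near: y; exists (e / (K + 1)) => //=.
  rewrite ltr_pdivlMr ?ltr_wpDl//; apply: le_lt_trans.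
  by rewrite mulrC ler_wpM2l// lerDl.
(* The Lipschitz constant is [K + 1] because [picard] asks for a positive one. *)
have [||||y yP] := @picard R unit (fun t a _ => g (a tt)) (fun=> z0) (K + 1) K.
- by rewrite ltr_wpDl.
- move=> t t0 a b D aD _; apply: le_trans (gK _ _) _.
  by rewrite ler_pM// lerDl.
- by move=> t _ _; exact: gB.
- move=> y cy _ t; apply: (@continuous_comp _ _ _ (y tt) g); first exact: cy.
  exact: gc.
have [cz z00 dz] := yP tt; exists (y tt); split=> // t t0.
suff zM : `|y tt t| <= M.
  by rewrite -[X in - X * _](clamp_id M)// -[X in evenpoly _ _ X](clamp_id M)//; exact: dz.
have wP := primitiveX _ _ 2 (primitive_continuous _ _ cz dz).
rewrite -ler_sqr ?nnegrE// /M !real_normK ?num_real// -z00.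
apply: (primitive_nincr _ _ 0 (lexx _) wP) => //; last exact: ltW.
move=> s s0 /=; rewrite expr1 /g.
have := mulr_ge0 (mul_clamp_ge0 M (y tt s) M0) (evenpoly_ge0 (clamp M (y tt s))).
by lra.
Unshelve. all: by end_near. Qed.

End EvenPolynomial.

Lemma cvg_meval {R : realType} {T : Type} (F : set_system T) {FF : Filter F} n
    (P : mpoly.mpoly n R) (y : 'I_n -> T -> R) (l : 'I_n -> R) :
  (forall i, y i t @[t --> F] --> l i) ->
  mpoly.meval (y^~ t) P @[t --> F] --> mpoly.meval l P.
Proof.
move=> yl; under eq_cvg do rewrite mpoly.mevalE; rewrite mpoly.mevalE.
apply: cvg_big => [|m _]; first exact: add_continuous.
apply: cvgM; first exact: cvg_cst.
apply: cvg_big => [|i _]; first exact: mul_continuous.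
exact: continuous_cvg (@exprn_continuous _ _ _) (yl i).
Qed.

(** * Null hyperplanes *)

Section NullHyperplane.
Context {R : realType}.

Lemma lebesgue_null_subset N (A B : set 'rV[R]_N) :
  A `<=` B -> lebesgue_null B -> lebesgue_null A.
Proof.
move=> AB nB e /nB[a [b [ab Bc le_e]]]; exists a, b; split=> //.
exact: subset_trans Bc.
Qed.

(* Box number [k] has sides [2 * k.+1] along the hyperplane, and a thickness
   which makes its volume [e / 2 ^ (k + 2)]. *)
Lemma lebesgue_null_hyperplane n :
  lebesgue_null [set x : 'rV[R]_(n + 1) | x 0 (rshift n 0) = 0].
Proof.
move=> e e0.
pose vol (k : nat) : R := (2 * k.+1%:R) ^+ n.
have vol0 k : 0 < vol k by rewrite exprn_gt0// mulr_gt0.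
pose h (k : nat) : R := e / (2 ^ (k + 2))%:R / vol k / 2.
have h0 k : 0 < h k by rewrite !divr_gt0// ltr0n expn_gt0.
pose b (k : nat) : 'rV[R]_(n + 1) := row_mx (const_mx k.+1%:R) (const_mx (h k)).
exists (fun k => - b k), b; split.
- move=> k i; rewrite mxE -subr_ge0 opprK /b.
  case: (split_ordP i) => j ->; rewrite ?row_mxEl ?row_mxEr mxE addr_ge0//.
    exact: ltW.
  exact: ltW.
- move=> x /= x0; have [k kP] : exists k : nat, forall i, `|x 0 i| <= k.+1%:R.
    exists (Num.bound `|x|) => i; apply: (@le_trans _ _ `|x|).
      by rewrite [leRHS]/Num.Def.normr/= mx_normrE; exact: (le_bigmax _ _ (0, i)).
    apply: le_trans (ltW (archi_boundP (normr_ge0 _))) _.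
    by rewrite ler_nat.
  exists k => // i; rewrite mxE /b; case: (split_ordP i) => j ->.
    rewrite row_mxEl mxE -ler_norml; exact: kP.
  rewrite row_mxEr mxE ord1 x0 oppr_le0 andbb; exact: ltW.
- have volE k : \prod_(i < n + 1) (b k 0 i - (- b k) 0 i) = e / (2 ^ (k + 2))%:R.
    rewrite big_split_ord/= big_ord1.
    rewrite (eq_bigr (fun=> 2 * k.+1%:R)) => [|i _]; last first.
      by rewrite !mxE (unsplitK (inl i)) !mxE opprK mulr_natl.
    rewrite prodr_const card_ord -/(vol k) !mxE (unsplitK (inr ord0)) !mxE opprK /h.
    by field; rewrite pnatr_eq0 -lt0n expn_gt0/= gt_eqF.
  under eq_eseriesr do rewrite volE.
  (* The volumes [e / 2 ^ (k + 2)] sum to [e / 2]. *)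
  apply: (@le_trans _ _ (e / 2 ^+ 1)%:E).
    rewrite le_eqVlt; apply/orP; left; apply/eqP.
    by apply: cvg_lim => //; exact: (@cvg_geometric_eseries_half R e 1).
  by rewrite lee_fin ler_pdivrMr// expr1 ler_pMr// ler1n.
Qed.

End NullHyperplane.

(** * The system *)

(** The equation is linear in [(u, v)] with bounded coefficients, hence globally Lipschitz, and
    [picard] applies with [false] indexing [u] and [true] indexing [v]. *)
Lemma exists_block_solution {R : realType} (lam A1 K u0 v0 : R) (r a b : R -> R) :
  continuous r -> continuous a -> continuous b ->
  (forall t : R, 0 <= t -> [/\ `|r t| <= K, `|a t| <= K & `|b t| <= K]) ->
  exists u v : R -> R,
    [/\ continuous u /\ continuous v, u 0 = u0 /\ v 0 = v0,
     forall t : R, 0 < t -> is_derive t 1 u (- v t +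
       r t * (lam * u t + b t * (A1 * (a t * u t + b t * v t)))) &
     forall t : R, 0 < t -> is_derive t 1 v (u t +
       r t * (lam * v t - a t * (A1 * (a t * u t + b t * v t))))].
Proof.
move=> cr ca cb rabK.
have K0 : 0 <= K by have [rK _ _] := rabK 0 (lexx _); exact: le_trans rK.
pose f (t : R) (y : bool -> R) (i : bool) : R :=
  if i then y false + r t * (lam * y true - a t * (A1 * (a t * y false + b t * y true)))
  else - y true + r t * (lam * y false + b t * (A1 * (a t * y false + b t * y true))).
(* The 1 bounds the rotation; [2 * K] bounds the linear form [a u + b v], and the two outer factors
   [K] bound its coefficient [a] or [b] and [r]. *)
pose L := 1 + K * (`|lam| + K * (`|A1| * (2 * K))).
have L0 : 0 < L by rewrite ltr_pwDl// !(mulr_ge0, addr_ge0).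
have fle t y D : 0 <= t -> (forall i, `|y i| <= D) -> forall i, `|f t y i| <= L * D.
  move=> t0 yD; have [rK aK bK] := rabK t t0.
  have D0 : 0 <= D by exact: le_trans (yD true).
  have lin : `|A1 * (a t * y false + b t * y true)| <= `|A1| * (2 * K * D).
    rewrite normrM ler_wpM2l// (le_trans (ler_normD _ _))// !normrM.
    have := ler_pM (normr_ge0 _) (normr_ge0 _) aK (yD false).
    by have := ler_pM (normr_ge0 _) (normr_ge0 _) bK (yD true); lra.
  have main (c w : R) : `|c| <= K -> `|w| <= D ->
      `|r t * (lam * w + c * (A1 * (a t * y false + b t * y true)))| <=
      K * (`|lam| + K * (`|A1| * (2 * K))) * D.
    move=> cK wD; rewrite normrM -mulrA ler_pM// mulrDl.
    rewrite (le_trans (ler_normD _ _))// !normrM -[leLHS]/(_ + _) lerD//.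
      exact: ler_wpM2l.
    rewrite -mulrA ler_pM// -normrM; apply: le_trans lin _.
    by rewrite !mulrA.
  rewrite /L mulrDl mul1r; case=> /=.
  - rewrite -[- (a t * _)]mulNr (le_trans (ler_normD _ _))// lerD//.
    by apply: main; rewrite ?normrN.
  - by rewrite (le_trans (ler_normD _ _))// normrN lerD//; exact: main.
(* Linearity reduces the Lipschitz estimate to the growth bound [fle]. *)
have fB t y y' i : f t y i - f t y' i = f t (fun j => y j - y' j) i.
  by case: i => /=; rewrite /f; ring.
pose y0 i := if i then v0 else u0.
have [|||y yP] := @picard R bool f y0 L (L * Num.max `|u0| `|v0|) L0.
- by move=> t t0 y y' D yD i; rewrite fB; apply: fle.
- move=> t i t0; apply: fle => // -[]; rewrite /y0 le_max lexx//.
  by rewrite orbT.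
- move=> y cy i t.
  have cf := cy false t; have ct := cy true t.
  have lin : A1 * (a s * y false s + b s * y true s) @[s --> t] -->
      A1 * (a t * y false t + b t * y true t).
    apply: cvgM; first exact: cvg_cst.
    by apply: cvgD; apply: cvgM => //; [exact: ca|exact: cb].
  case: i; apply: cvgD => //; rewrite /f.
  + apply: cvgM; first exact: cr.
    by apply: cvgB; apply: cvgM => //; [exact: cvg_cst|exact: ca].
  + exact: cvgN.
  + apply: cvgM; first exact: cr.
    by apply: cvgD; apply: cvgM => //; [exact: cvg_cst|exact: cb].
have [cu u00 du] := yP false; have [cv v00 dv] := yP true.
by exists (y false), (y true).
Qed.

(** * Limits, derivatives and solutions coordinatewise *)

Section RowVectors.
Context {R : realType}.

Lemma cvg_rVP {T : Type} (F : set_system T) {FF : Filter F} N (X : T -> 'rV[R]_N)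
    (l : 'rV[R]_N) :
  X t @[t --> F] --> l <-> forall i, X t 0 i @[t --> F] --> l 0 i.
Proof.
split=> [Xl i|Xl].
  apply/cvgrPdist_le => e e0; move/cvgrPdist_le : Xl => /(_ e e0).
  apply: filterS => t; apply: le_trans.
  rewrite [leRHS]/Num.Def.normr/= mx_normrE.
  by apply: le_trans (le_bigmax _ _ (0, i)); rewrite !mxE.
apply/cvgrPdist_le => e e0; near=> t.
rewrite /Num.Def.normr/= mx_normrE (bigmax_le _ (ltW e0))//= => -[j i] _.
rewrite !mxE/= ord1; move: i {j}; near: t; apply: filter_forall => i.
by move/cvgrPdist_le : (Xl i); exact.
Unshelve. all: by end_near. Qed.

Lemma is_derive_rVP N (X : R -> 'rV[R]_N) (t : R) (D : 'rV[R]_N) :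
  is_derive t 1 X D <-> forall i, is_derive t 1 (fun s => X s 0 i) (D 0 i).
Proof.
split=> [[dX <-] i|dX].
  split; first by move/derivable_mxP : dX.
  by rewrite derive_mx// mxE.
have dX' : derivable X t 1.
  by apply/derivable_mxP => j i; rewrite ord1; have [] := dX i.
split => //; apply/rowP => i; rewrite derive_mx// mxE.
by have [_] := dX i.
Qed.

Lemma forward_solutionP N (F : 'rV[R]_N -> 'rV[R]_N) x0 X :
  forward_solution F x0 X <->
  X 0 = x0 /\ forall i, primitive (fun t => X t 0 i) (fun t => F (X t) 0 i).
Proof.
split=> [[X0 cX dX]|[X0 XP]]; split=> //.
- move=> i; split.
    apply/subspace_continuousP => t t0.
    by move/subspace_continuousP : cX => /(_ t t0)/cvg_rVP; exact.
  by move=> t /dX/is_derive_rVP; exact.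
- apply/subspace_continuousP => t t0; apply/cvg_rVP => i.
  by have [cXi _] := XP i; move/subspace_continuousP : cXi => /(_ t t0).
- by move=> t t0; apply/is_derive_rVP => i; have [_] := XP i; exact.
Qed.

End RowVectors.

(** * Existence and asymptotics for the triangular system *)

Section System.
Context {R : realType}.
Variables (n k : nat) (lam A1 : R) (d : nat -> R).
Variables p q : forall j : nat, mpoly.mpoly j.*2 R.
Hypothesis n_even : ~~ odd n.
Hypothesis hk : (1 <= k)%N.
Hypothesis hA1 : A1 < 0.
Hypothesis hd : forall l : nat, (1 <= l <= k)%N -> 0 < d l.*2.
Hypothesis hpq : forall j : nat, (j < n./2)%N -> p j = q j \/ p j = - q j.
Hypothesis hp : forall j : nat, (j < n./2)%N ->
  forall v : 'I_j.*2 -> R, mpoly.meval v (p j) ^+ 2 < lam / A1.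

Let F : 'rV[R]_(n + 1) -> 'rV[R]_(n + 1) :=
  Ffield lam (evenpoly k d) (Hfield (fun T : R => A1 * T) p q).

(** Reading coordinates from an infinite sequence lets the blocks be solved one after another
    without changing dimension. *)
Let coef (c : forall j : nat, mpoly.mpoly j.*2 R) (x : nat -> R) (j : nat) : R :=
  mpoly.meval (fun i : 'I_j.*2 => x i) (c j).

Let eq_coef c x y j : (forall i, (i < j.*2)%N -> x i = y i) -> coef c x j = coef c y j.
Proof. by move=> xy; apply: mpoly.meval_eq => i; exact: xy. Qed.

(* Parity is that of the 1-based coordinate indices x_(2j+1), x_(2j+2). *)
Let odd_field (r : R) (x : nat -> R) (j : nat) : R := - x j.*2.+1 +
  r * (lam * x j.*2 + coef q x j * (A1 * (coef p x j * x j.*2 + coef q x j * x j.*2.+1))).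

Let even_field (r : R) (x : nat -> R) (j : nat) : R := x j.*2 +
  r * (lam * x j.*2.+1 - coef p x j * (A1 * (coef p x j * x j.*2 + coef q x j * x j.*2.+1))).

(** This is the triangular structure: later blocks do not enter. *)
Let eq_fields r x y j : (forall i, (i < j.+1.*2)%N -> x i = y i) ->
  odd_field r x j = odd_field r y j /\ even_field r x j = even_field r y j.
Proof.
move=> xy; have xy' i : (i < j.*2)%N -> x i = y i.
  by move=> ij; apply: xy; rewrite doubleS ltnW// ltnW.
rewrite /odd_field /even_field !(eq_coef _ _ _ _ xy') !xy// doubleS//.
Qed.

(** From [(|a| - 1) ^+ 2 >= 0] one gets [|a| <= 1 + a ^+ 2], a bound that avoids the square root of
    [lam / A1]. *)
Let coefs_le j x : (j < n./2)%N ->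
  [/\ coef q x j = coef p x j \/ coef q x j = - coef p x j,
      `|coef p x j| <= 1 + lam / A1 & `|coef q x j| <= 1 + lam / A1].
Proof.
move=> jn; have qp : coef q x j = coef p x j \/ coef q x j = - coef p x j.
  rewrite /coef; case: (hpq _ jn) => ->; [by left|right].
  by rewrite mpoly.mevalN opprK.
have pK : `|coef p x j| <= 1 + lam / A1.
  have := hp _ jn (fun i => x i); rewrite -/(coef p x j) -real_normK ?num_real//.
  have := sqr_ge0 (`|coef p x j| - 1); have := normr_ge0 (coef p x j).
  by rewrite sqrrB; lra.
by split=> //; case: qp => ->; rewrite ?normrN.
Qed.

Lemma sqr_le_cvg0 (x e : R -> R) : (forall t, x t ^+ 2 <= e t) ->
  e t @[t --> +oo] --> 0 -> x t @[t --> +oo] --> 0.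
Proof.
move=> xe e0; apply/cvgrPdist_lt => eps eps0.
have ee : 0 < eps ^+ 2 by rewrite exprn_gt0.
near=> t; rewrite sub0r normrN -ltr_sqr ?nnegrE ?(ltW eps0)// real_normK ?num_real//.
apply: le_lt_trans (xe t) _; apply: le_lt_trans (ler_norm _) _.
rewrite -normrN -sub0r; near: t; move/cvgrPdist_lt : e0; exact.
Unshelve. all: by end_near. Qed.

(** Induction on the number of solved blocks. Once those before block [m] are known, its
    coefficients are given continuous functions. Unsolved coordinates stay constant as
    placeholders. *)
Lemma exists_triangular_solution (r : R -> R) (K : R) (x0 : nat -> R) m :
  (m <= n./2)%N -> continuous r -> (forall t : R, 0 <= t -> `|r t| <= K) ->
  exists c : nat -> R -> R,
    [/\ forall i, continuous (c i), forall i, c i 0 = x0 i &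
        forall j, (j < m)%N ->
        (forall t : R, 0 < t -> is_derive t 1 (c j.*2) (odd_field (r t) (c^~ t) j)) /\
        (forall t : R, 0 < t -> is_derive t 1 (c j.*2.+1) (even_field (r t) (c^~ t) j))].
Proof.
move=> + cr rK; elim: m => [|m IHm] mn.
  by exists (fun i _ => x0 i); split=> // i; exact: cst_continuous.
have [c [cc c0 dc]] := IHm (ltnW mn).
have ccoef e : continuous (fun t => coef e (c^~ t) m).
  by move=> t; apply: cvg_meval => i; exact: cc.
have [t t0|u [v [[cu cv] [u0 v0] du dv]]] := exists_block_solution lam A1
    (Num.max K (1 + lam / A1)) (x0 m.*2) (x0 m.*2.+1) _ _ _ cr (ccoef p) (ccoef q).
  have [_ pK qK] := coefs_le m (c^~ t) mn.
  by rewrite !le_max rK// pK qK !orbT.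
pose c' i := if i == m.*2 then u else if i == m.*2.+1 then v else c i.
have c'lt i : (i < m.*2)%N -> c' i = c i.
  by move=> im; rewrite /c' !ltn_eqF// ltnS ltnW.
have c'u : c' m.*2 = u by rewrite /c' eqxx.
have c'v : c' m.*2.+1 = v by rewrite /c' eqxx gtn_eqF.
exists c'; split.
- by move=> i; rewrite /c'; case: ifP => _; [|case: ifP => _].
- by move=> i; rewrite /c'; case: eqP => [->|_] //; case: eqP => [->|_] //.
move=> j; rewrite ltnS leq_eqVlt => /predU1P[->|jm].
  have ce e t : coef e (c'^~ t) m = coef e (c^~ t) m.
    by apply: eq_coef => i im; rewrite c'lt.
  rewrite /odd_field /even_field c'u c'v; split=> t t0.
    by rewrite !ce; exact: du.
  by rewrite !ce; exact: dv.
(* Earlier blocks keep their equations, since these involve only coordinates that [c'] leaves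
   unchanged. *)
have jm2 : (j.+1.*2 <= m.*2)%N by rewrite leq_double.
have cj t : forall i, (i < j.+1.*2)%N -> c' i t = c i t.
  by move=> i ij; rewrite c'lt// (leq_trans ij).
rewrite !c'lt; [|by rewrite -doubleS|by rewrite (leq_trans _ jm2)// doubleS].
have [d1 d2] := dc _ jm; split=> t t0; have [e1 e2] := eq_fields (r t) _ _ _ (cj t).
  by rewrite e1; exact: d1.
by rewrite e2; exact: d2.
Qed.

Let crd (X : 'rV[R]_(n + 1)) : nat -> R := coordn (lsubmx X).
Let last (X : 'rV[R]_(n + 1)) : R := rsubmx X 0 0.

Let crdE X (i : 'I_n) : crd X i = X 0 (lshift 1 i).
Proof. by rewrite /crd /coordn valK/= mxE. Qed.

Let lastE X : last X = X 0 (rshift n 0).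
Proof. by rewrite /last mxE. Qed.

(** As [n] is even, the blocks exhaust the indices below [n]. *)
Let ord_block (P : nat -> Prop) :
  (forall j, (j < n./2)%N -> P j.*2 /\ P j.*2.+1) -> forall i, (i < n)%N -> P i.
Proof.
move=> Pj i in_; have nE : n = n./2.*2 by rewrite -[LHS]odd_double_half (negPf n_even).
have ij : (i./2 < n./2)%N.
  rewrite -ltn_double -nE (leq_ltn_trans _ in_)//.
  by rewrite -[leqRHS]odd_double_half leq_addl.
have [Pe Po] := Pj _ ij; rewrite -[i]odd_double_half.
by case: (odd i).
Qed.

Let block_lt j : (j < n./2)%N -> (j.*2.+1 < n)%N.
Proof.
move=> jn; rewrite (@leq_trans n./2.*2)//; first by rewrite -doubleS leq_double.
by rewrite -[leqRHS]odd_double_half leq_addl.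
Qed.

Let crd_Ffield X j : (j < n./2)%N ->
  crd (F X) j.*2 = odd_field (evenpoly k d (last X)) (crd X) j /\
  crd (F X) j.*2.+1 = even_field (evenpoly k d (last X)) (crd X) j.
Proof.
move=> jn; have lt1 := block_lt j jn; have lt0 := ltnW lt1.
have -> : crd (F X) j.*2 = F X 0 (lshift 1 (Ordinal lt0)) := crdE _ (Ordinal lt0).
have -> : crd (F X) j.*2.+1 = F X 0 (lshift 1 (Ordinal lt1)) := crdE _ (Ordinal lt1).
have x0 : lsubmx X 0 (Ordinal lt0) = crd X j.*2.
  by rewrite [RHS](crdE X (Ordinal lt0)) mxE.
have x1 : lsubmx X 0 (Ordinal lt1) = crd X j.*2.+1.
  by rewrite [RHS](crdE X (Ordinal lt1)) mxE.
have Fl i : F X 0 (lshift 1 i) = rotation (lsubmx X) 0 i + evenpoly k d (last X) *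
    (lam * lsubmx X 0 i + Hfield (fun T : R => A1 * T) p q (lsubmx X) 0 i).
  rewrite /F /Ffield mxE row_mxEl [X in _ + X]mxE row_mxEl [X in _ * X]mxE.
  by congr (_ + _ * (_ + _)); rewrite mxE.
rewrite !Fl x0 x1; split.
  by rewrite !mxE /= odd_double doubleK.
by rewrite !mxE /= odd_double/= uphalf_double mulNr.
Qed.

Let last_Ffield X : last (F X) = - last X * evenpoly k d (last X).
Proof.
rewrite [LHS]lastE /F /Ffield mxE row_mxEr [X in _ + X]mxE row_mxEr !mxE.
by rewrite mulr1n mulr0 addr0 !lastE.
Qed.

Let solution_coordinates X0 X : forward_solution F X0 X ->
  [/\ X 0 = X0,
      primitive (fun t => last (X t)) (fun t => - last (X t) * evenpoly k d (last (X t)))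
    & forall j, (j < n./2)%N ->
      primitive (fun t => crd (X t) j.*2)
        (fun t => odd_field (evenpoly k d (last (X t))) (crd (X t)) j) /\
      primitive (fun t => crd (X t) j.*2.+1)
        (fun t => even_field (evenpoly k d (last (X t))) (crd (X t)) j)].
Proof.
move=> /forward_solutionP[X00 XP].
have cP i : (i < n)%N -> primitive (fun t => crd (X t) i) (fun t => crd (F (X t)) i).
  move=> in_; have e Y : crd Y i = Y 0 (lshift 1 (Ordinal in_)) := crdE Y (Ordinal in_).
  under eq_fun do rewrite e.
  by under [X in primitive _ X]eq_fun do rewrite e.
split=> [//||j jn].
  have := XP (rshift n 0); under eq_fun do rewrite -lastE.
  by under [X in primitive _ X]eq_fun do rewrite -lastE last_Ffield.
have lt1 := block_lt j jn.
split; [apply: primitive_eq (cP _ (ltnW lt1))|apply: primitive_eq (cP _ lt1)] => t _.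
  by have [-> _] := crd_Ffield (X t) j jn.
by have [_ ->] := crd_Ffield (X t) j jn.
Qed.

Lemma exists_forward_solution X0 : exists X, forward_solution F X0 X.
Proof.
have [z [cz z0 dz]] := exists_scalar_solution k d hk hd (last X0).
have zP := primitiveX _ _ 2 (primitive_continuous _ _ cz dz).
(* Since [|z|] never exceeds its initial value, R(z) stays below its initial value, the bound
   required to solve the blocks. *)
have zle t : 0 <= t -> `|z t| <= `|last X0|.
  move=> t0; rewrite -ler_sqr ?nnegrE// !real_normK ?num_real// -z0.
  apply: (primitive_nincr _ _ 0 (lexx _) zP) => // s s0 /=.
  by have := mulr_ge0 (sqr_ge0 (z s)) (evenpoly_ge0 k d hk hd (z s)); lra.
pose r t := evenpoly k d (z t).
have cr : continuous r.
  by move=> t; apply: continuous_cvg (cz t); exact: continuous_evenpoly.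
have [t t0|c [cc c0 dc]] := exists_triangular_solution r (evenpoly k d (last X0)) (crd X0)
    n./2 (leqnn _) cr.
  by rewrite ger0_norm ?evenpoly_ge0//; apply: evenpoly_le => //; exact: zle.
pose X t : 'rV[R]_(n + 1) := row_mx (\row_(i < n) c i t) (const_mx (z t)).
have lastX t : last (X t) = z t by rewrite lastE row_mxEr mxE.
have crdX i t : (i < n)%N -> crd (X t) i = c i t.
  move=> in_; have -> : crd (X t) i = X t 0 (lshift 1 (Ordinal in_)) := crdE _ (Ordinal in_).
  by rewrite row_mxEl mxE.
exists X; apply/forward_solutionP; split.
  apply/rowP => i; case: (split_ordP i) => j ->; rewrite ?row_mxEl ?row_mxEr mxE.
    by rewrite c0 crdE.
  by rewrite ord1 z0 lastE.
move=> i; case: (split_ordP i) => j ->; last first.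
  rewrite ord1; under eq_fun do rewrite -lastE lastX.
  under [X in primitive _ X]eq_fun do rewrite -lastE last_Ffield lastX.
  exact: primitive_continuous.
under eq_fun do rewrite -crdE crdX//.
under [X in primitive _ X]eq_fun do rewrite -crdE.
apply: (ord_block (fun i => primitive (c i) (fun t => crd (F (X t)) i))); last exact: ltn_ord.
move=> m mn; have [d1 d2] := dc _ mn; have lt1 := block_lt m mn.
have fE t : odd_field (r t) (crd (X t)) m = odd_field (r t) (c^~ t) m /\
    even_field (r t) (crd (X t)) m = even_field (r t) (c^~ t) m.
  by apply: eq_fields => l lm; apply: crdX; rewrite (leq_trans lm)// doubleS.
split; apply: primitive_continuous => // t t0;
  have [FE1 FE2] := crd_Ffield (X t) m mn; have [fE1 fE2] := fE t.
  by rewrite FE1 lastX fE1; exact: d1.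
by rewrite FE2 lastX fE2; exact: d2.
Qed.

Lemma scalar_energy X0 X : forward_solution F X0 X ->
  primitive (fun t => last (X t) ^+ 2)
    (fun t => - (2 * evenpoly k d (last (X t))) * last (X t) ^+ 2).
Proof.
move=> /solution_coordinates[_ zP _].
by apply: primitive_eq (primitiveX _ _ 2 zP) => t _ /=; ring.
Qed.

(** The square of the last coordinate is nonnegative, nonincreasing and starts at 0, so the
    hyperplane is invariant. *)
Lemma last_solution0 X0 X : forward_solution F X0 X -> last X0 = 0 ->
  forall t : R, 0 <= t -> last (X t) = 0.
Proof.
move=> XP z0 t t0; have [X00 _ _] := solution_coordinates _ _ XP.
apply/eqP; rewrite -sqrf_eq0 eq_le sqr_ge0 andbT.
have <- : last (X 0) ^+ 2 = 0 by rewrite X00 z0 expr0n.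
apply: (primitive_nincr _ _ 0 (lexx _) (scalar_energy _ _ XP)) => // s s0.
rewrite mulNr oppr_le0; apply: mulr_ge0; last exact: sqr_ge0.
by apply: mulr_ge0; rewrite ?evenpoly_ge0.
Qed.

Lemma solution_cvg0 X0 X : last X0 != 0 -> forward_solution F X0 X ->
  X t @[t --> +oo] --> (0 : 'rV[R]_(n + 1)).
Proof.
move=> z0 XP; have [X00 zP cP] := solution_coordinates _ _ XP.
pose z t := last (X t); pose w t := z t ^+ 2; pose r t := evenpoly k d (z t).
have r_ge0 t : 0 <= r t by exact: evenpoly_ge0.
have wP : primitive w (fun t => - (2 * r t) * w t) := scalar_energy _ _ XP.
have wd := primitive_nincr _ _ 0 (lexx _) wP.
have w0 : w 0 = last X0 ^+ 2 by rewrite /w /z X00.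
(* As R(z) is at least [d 2 * w], one has [w' <= - (2 * d 2) * w ^+ 2]. *)
have wcvg : w t @[t --> +oo] --> 0.
  apply: (quadratic_decay _ _ (2 * d 2) _ wP) => [|t _|t t0].
  - by rewrite mulr_gt0// (hd 1).
  - exact: sqr_ge0.
  - have := ler_wpM2r (sqr_ge0 (z t)) (evenpoly_ge k d hk hd (z t)).
    by rewrite -/(r t) /w; lra.
(* R(z) is bounded by its initial value, so [w] decays at most exponentially. *)
have wgt0 : forall t : R, 0 <= t -> 0 < w t.
  apply: (linear_decay_gt0 _ _ (2 * evenpoly k d (last X0)) wP) => [t _|t t0|].
  - exact: sqr_ge0.
  - rewrite ler_pM2l// evenpoly_le// -ler_sqr ?nnegrE// !real_normK ?num_real//.
    rewrite -w0; apply: wd => //; last exact: ltW.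
    by move=> s s0; rewrite mulNr oppr_le0; apply: mulr_ge0; [exact: mulr_ge0|exact: sqr_ge0].
  - by rewrite w0 lt_neqAle sqr_ge0 andbT eq_sym sqrf_eq0.
have blocks m : (m <= n./2)%N ->
    forall i, (i < m.*2)%N -> crd (X t) i @[t --> +oo] --> 0.
  elim: m => [//|m IHm] mn i.
  have [uP vP] := cP _ mn.
  pose u t := crd (X t) m.*2; pose v t := crd (X t) m.*2.+1.
  pose a t := coef p (crd (X t)) m; pose b t := coef q (crd (X t)) m.
  (* [al] is the limit of [a ^+ 2], by induction on the blocks, and [s] is the midpoint between it
     and [lam / A1]; as [A1 < 0], the rate [A1 * s - lam] is positive. *)
  pose al := mpoly.meval (fun=> 0) (p m) ^+ 2; pose s := (al + lam / A1) / 2.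
  have alle : al < lam / A1 by exact: hp.
  have s1 : al < s by rewrite /s; lra.
  have s2 : s < lam / A1 by rewrite /s; lra.
  have acvg : a t ^+ 2 @[t --> +oo] --> al.
    have acvg : a t @[t --> +oo] --> mpoly.meval (fun=> 0) (p m).
      by apply: cvg_meval => j; apply: IHm (ltnW mn) _ _.
    exact: (cvgM acvg acvg).
  have [T [_ aT]] : \forall t \near +oo, a t ^+ 2 < s by move/cvgr_lt : acvg; exact.
  pose E t := u t ^+ 2 + v t ^+ 2.
  have EP := block_energy lam A1 r a b u v uP vP.
  have Ecvg : E t @[t --> +oo] --> 0.
    apply: (comparison_cvg0 _ _ _ (fun t => 2 * r t) (A1 * s - lam) (Num.max 0 T)
      _ _ EP wP _ _ wgt0 wcvg).
    - by rewrite le_max lexx.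
    - by rewrite subr_gt0 mulrC -ltr_ndivlMr.
    - by move=> t; rewrite mulr_ge0.
    - by move=> t; rewrite addr_ge0// sqr_ge0.
    - move=> t; rewrite gt_max => /andP[t0 Tt].
      apply: le_trans (block_energy_le lam A1 r a b u v hA1 s t _ _ _) _ => //.
      + by have [] := coefs_le m (crd (X t)) mn.
      + by apply: ltW; exact: aT.
      + by rewrite /E; lra.
  rewrite doubleS !ltnS leq_eqVlt => /predU1P[->|].
    by apply: sqr_le_cvg0 Ecvg => t; rewrite /E lerDr sqr_ge0.
  rewrite ltnS leq_eqVlt => /predU1P[->|im]; last exact: IHm (ltnW mn) _ im.
  by apply: sqr_le_cvg0 Ecvg => t; rewrite /E lerDl sqr_ge0.
apply/cvg_rVP => i; rewrite mxE; case: (split_ordP i) => j ->.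
  under eq_cvg do rewrite -crdE.
  apply: blocks (leqnn _) _ _; apply: leq_trans (ltn_ord j) _.
  by rewrite -{1}[n]odd_double_half (negPf n_even).
rewrite ord1; under eq_cvg do rewrite -lastE.
exact: sqr_le_cvg0 wcvg.
Qed.

Lemma almost_global_attractor_Ffield : almost_global_attractor F.
Proof.
apply: lebesgue_null_subset (lebesgue_null_hyperplane n) => X0 /= X0P.
rewrite -lastE; apply: contrapT => /eqP z0; apply: X0P; split.
  exact: exists_forward_solution.
by move=> X; exact: solution_cvg0.
Qed.

Lemma not_locally_attractive_Ffield : (2 <= n)%N -> ~ locally_attractive F.
Proof.
move=> n2 [e e0 attr].
have n0 : (0 < n./2)%N by rewrite half_gt0.
have lt1 := block_lt 0 n0; have lt0 := ltnW lt1.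
(* A point of the hyperplane z = 0 inside the given ball, with first block energy [(e / 2) ^+ 2]. *)
pose X0 : 'rV[R]_(n + 1) := (e / 2) *: delta_mx 0 (lshift 1 (Ordinal lt0)).
have X0e : `|X0| < e.
  rewrite /X0 normrZ gtr0_norm ?divr_gt0//.
  apply: (@le_lt_trans _ _ (e / 2 * 1)); last by rewrite mulr1; lra.
  rewrite ler_wpM2l//; first by rewrite divr_ge0// ltW.
  rewrite /Num.Def.normr/= mx_normrE (bigmax_le _ ler01)//= => -[i j] _.
  by rewrite mxE; case: (_ && _); rewrite ?normr1 ?normr0.
have [[X XP] /(_ _ XP) Xcvg] := attr _ X0e.
have z0 : last X0 = 0.
  by rewrite lastE !mxE eq_rlshift andbF mulr0.
have zt := last_solution0 _ _ XP z0.
have [X00 _ /(_ 0 n0)[uP vP]] := solution_coordinates _ _ XP.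
pose u t := crd (X t) 0; pose v t := crd (X t) 1.
have EP := primitiveD _ _ _ _ (primitiveX _ _ 2 uP) (primitiveX _ _ 2 vP).
(* R(0) = 0 leaves only the rotation, which preserves the energy. *)
have E0P : primitive (fun t => u t ^+ 2 + v t ^+ 2) (fun=> 0).
  apply: primitive_eq EP => t t0; rewrite /odd_field /even_field.
  by rewrite (zt _ (ltW t0)) evenpoly0 !mul0r !addr0 /=; ring.
have ucvg : u t @[t --> +oo] --> 0.
  move/cvg_rVP : Xcvg => /(_ (lshift 1 (Ordinal lt0))); rewrite mxE.
  by under eq_cvg do rewrite -crdE.
have vcvg : v t @[t --> +oo] --> 0.
  move/cvg_rVP : Xcvg => /(_ (lshift 1 (Ordinal lt1))); rewrite mxE.
  by under eq_cvg do rewrite -crdE.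
have Ecvg : u t ^+ 2 + v t ^+ 2 @[t --> +oo] --> (0 ^+ 2 + 0 ^+ 2 : R).
  exact: (cvgD (cvgM ucvg ucvg) (cvgM vcvg vcvg)).
have u0 : u 0 = e / 2.
  rewrite [u 0](crdE (X 0) (Ordinal lt0)).
  by rewrite X00 !mxE !eqxx mulr1.
have Ege t : 0 <= t -> (e / 2) ^+ 2 <= u t ^+ 2 + v t ^+ 2.
  move=> t0; have := primitive_nincr _ _ 0 (lexx _) (primitiveN _ _ E0P) _ 0 t (lexx _) t0.
  rewrite lerN2 -u0 => H; apply: le_trans (H _); first by rewrite lerDl sqr_ge0.
  by move=> s _; rewrite oppr0.
have ee : 0 < (e / 2) ^+ 2 by rewrite exprn_gt0// divr_gt0.
move: Ecvg; rewrite expr0n addr0 => /cvgr_lt/(_ _ ee)[T [_ ET]].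
have := ET (Num.max 0 T + 1); rewrite ltr_pwDr ?le_max ?lexx ?orbT// => /(_ isT).
by rewrite ltNge Ege// addr_ge0// le_max lexx.
Qed.

End System.

Theorem corollary1 (R : realType) (n k : nat) (lam A1 : R) (d : nat -> R)
    (p q : forall j : nat, mpoly.mpoly j.*2 R)
    (hn : (2 <= n)%N) (n_even : ~~ odd n) (hk : (1 <= k)%N)
    (hlam : lam < 0) (hA1 : A1 < 0)
    (hd : forall l : nat, (1 <= l <= k)%N -> 0 < d l.*2)
    (hpq : forall j : nat, (j < n./2)%N -> p j = q j \/ p j = - q j)
    (hp : forall j : nat, (j < n./2)%N ->
      forall v : 'I_j.*2 -> R, mpoly.meval v (p j) ^+ 2 < lam / A1) :
  let f := fun T : R => A1 * T in
  let F : 'rV[R]_(n + 1) -> 'rV[R]_(n + 1) :=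
    Ffield lam (evenpoly k d) (Hfield f p q) in
  almost_global_attractor F /\ ~ locally_asymptotically_stable F.
Proof.
split; first exact: almost_global_attractor_Ffield.
(* Of the two halves of asymptotic stability, attractivity is the one refuted. *)
by move=> [_]; exact: not_locally_attractive_Ffield.
Qed.
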